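(* Suppose that $K$ is a set equipped with two metrics $d_0 \le d_1$ (i.e. $d_0(x,y)\le d_1(x,y)$ for all $x,y\in K$) such that $(K,d_0)$ and $(K,d_1)$ are both compact positive definite metric spaces. For $0\le t\le 1$ let $K_t = (K,d_t)$, where $$d_t(x,y) = -\log\bigl[(1-t)e^{-d_0(x,y)} + t e^{-d_1(x,y)}\bigr].$$ Then $$\mathrm{Mag}(K_t) \le (1-t)\,\mathrm{Mag}(K_0) + t\,\mathrm{Mag}(K_1)$$ for every $0\le t\le 1$. In other words, $\mathrm{Mag}(K_t)$ is convex in $t$.
   Context: For a finite metric space $X = \{1,\dots,n\}$ with metric $d$, the zeta matrix is the real $n\times n$ matrix $Z_X = (e^{-d(i,j)})_{i,j}$. If $Z_X$ is invertible, the magnitude is $\mathrm{Mag}(X) = \langle \mathbf{1}, Z_X^{-1}\mathbf{1}\rangle$, the sum of the entries of $Z_X^{-1}$ (where $\mathbf{1}\in\mathbb{R}^n$ has all entries $1$). A finite metric space $X$ is positive definite if $Z_X$ is a positive definite matrix. A compact metric space $K$ is positive definite if every finite metric subspace of $K$ is positive definite. The magnitude of a compact positive definite metric space $K$ is $\mathrm{Mag}(K) = \sup\{\mathrm{Mag}(X) : X\subseteq K \text{ finite}\}$, which may equal $+\infty$. Under the hypotheses of the claim, each $d_t$ ($0\le t\le1$) is a metric on $K$ for which $(K,d_t)$ is compact and positive definite, so $\mathrm{Mag}(K_t)\in[0,\infty]$ is defined. Arithmetic is in $[0,\infty]$ with the convention $0\cdot\infty=0$. *)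

(* Defs.v *)
From HB Require Import structures.
From mathcomp Require Import all_boot all_order all_algebra finmap.
From mathcomp Require Import boolp classical_sets reals ereal topology.
From mathcomp Require Import normedtype sequences exp lra.

Set Implicit Arguments.
Unset Strict Implicit.
Unset Printing Implicit Defensive.

Import Order.TTheory GRing.Theory Num.Theory.

Local Open Scope classical_set_scope.
Local Open Scope ring_scope.

(* A metric as a first-class object, so that one set can carry several. *)
Record metric (R : realType) (K : Type) := Metric {
  dist :> K -> K -> R ;
  distxx : forall x, dist x x = 0 ;
  dist_positivity : forall x y, dist x y = 0 -> x = y ;
  dist_sym : forall x y, dist x y = dist y x ;
  dist_triangle : forall y x z, dist x z <= dist x y + dist y z
}.

(* The pair (K, d) as a library metric space: an alias of K whose [mdist] is d
   and whose topology is the one induced by d. *)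
Definition metric_space (R : realType) (K : choiceType) (d : metric R K)
  : Type := K.

HB.instance Definition _ (R : realType) (K : choiceType) (d : metric R K) :=
  Choice.on (metric_space d).
HB.instance Definition _ (R : realType) (K : choiceType) (d : metric R K) :=
  @isMetric.Build R (metric_space d) d
    (distxx d) (@dist_positivity _ _ d) (dist_sym d) (dist_triangle d).

Definition posdef_mx (R : realType) (n : nat) (A : 'M[R]_n) : Prop :=
  A^T = A /\
  forall v : 'cV[R]_n, v != 0 -> 0 < (v^T *m A *m v) ord0 ord0.

(* The points of the finite subspace X are numbered by [enum_val]; the choice
   of numbering affects neither definiteness nor magnitude. *)
Definition zeta_mx (R : realType) (M : metricType R) (X : {fset M})
  : 'M[R]_#|{: X}| :=
  \matrix_(i, j) expR (- mdist (val (enum_val i)) (val (enum_val j))).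

Definition positive_definite (R : realType) (M : metricType R) : Prop :=
  forall X : {fset M}, posdef_mx (zeta_mx X).

(* Meaningful when [zeta_mx X] is invertible, as it is in every positive
   definite space. *)
Definition fin_magnitude (R : realType) (M : metricType R) (X : {fset M}) : R :=
  \sum_i \sum_j invmx (zeta_mx X) i j.

(* The empty set is among the finite subsets, so this is nonnegative. *)
Definition magnitude (R : realType) (M : metricType R) : \bar R :=
  ereal_sup [set (fin_magnitude X)%:E | X in [set: {fset M}]].

Section interpolation.
Context (R : realType) (K : choiceType) (d0 d1 : metric R K).
Hypothesis led : forall x y, d0 x y <= d1 x y.
Context (t : R).
Hypothesis t01 : 0 <= t <= 1.

Definition interp_dist (x y : K) : R :=
  - ln ((1 - t) * expR (- d0 x y) + t * expR (- d1 x y)).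

Lemma expR_interp x y : expR (- interp_dist x y) =
  (1 - t) * expR (- d0 x y) + t * expR (- d1 x y).
Proof.
rewrite opprK lnK// posrE.
have := expR_gt0 (- d0 x y); have := expR_gt0 (- d1 x y).
by have := t01; nra.
Qed.

Lemma interp_dist_le x y : interp_dist x y <= d1 x y.
Proof.
rewrite -lerN2 -ler_expR expR_interp.
have : expR (- d1 x y) <= expR (- d0 x y) by rewrite ler_expR lerN2.
by have := t01; nra.
Qed.

Lemma le_interp_dist x y : d0 x y <= interp_dist x y.
Proof.
rewrite -lerN2 -ler_expR expR_interp.
have : expR (- d1 x y) <= expR (- d0 x y) by rewrite ler_expR lerN2.
by have := t01; nra.
Qed.

Lemma dist_ge0 (d : metric R K) x y : 0 <= d x y.
Proof.
by have := dist_triangle d y x x; rewrite distxx (dist_sym d y x); lra.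
Qed.

Lemma interp_distxx x : interp_dist x x = 0.
Proof. by rewrite /interp_dist !distxx oppr0 expR0 !mulr1 subrK ln1 oppr0. Qed.

Lemma interp_dist_positivity x y : interp_dist x y = 0 -> x = y.
Proof.
move=> h; apply: (@dist_positivity _ _ d0); apply/le_anti.
by rewrite dist_ge0 andbT -h le_interp_dist.
Qed.

Lemma interp_dist_sym x y : interp_dist x y = interp_dist y x.
Proof. by rewrite /interp_dist (dist_sym d0) (dist_sym d1). Qed.

Lemma interp_dist_triangle y x z :
  interp_dist x z <= interp_dist x y + interp_dist y z.
Proof.
rewrite -lerN2 opprD -ler_expR expRD !expR_interp.
have h (d : metric R K) :
    expR (- d x y) * expR (- d y z) <= expR (- d x z).
  by rewrite -expRD ler_expR -opprD lerN2 dist_triangle.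
have := h d0; have := h d1.
have : expR (- d1 x y) <= expR (- d0 x y) by rewrite ler_expR lerN2.
have : expR (- d1 y z) <= expR (- d0 y z) by rewrite ler_expR lerN2.
move: t01 => /andP[].
move: (expR (- d0 x y)) (expR (- d1 x y)) (expR (- d0 y z)) (expR (- d1 y z))
  (expR (- d0 x z)) (expR (- d1 x z)) => a b a' b' A B t0 t1 ba' ba hB hA.
have h0 : 0 <= t * (1 - t) * ((a - b) * (a' - b')).
  by rewrite !mulr_ge0// subr_ge0.
have h1 : 0 <= t * (B - b * b') by rewrite mulr_ge0// subr_ge0.
have h2 : 0 <= (1 - t) * (A - a * a') by rewrite mulr_ge0// subr_ge0.
by lra.
Qed.

Definition interp_metric : metric R K :=
  Metric interp_distxx interp_dist_positivity
    interp_dist_sym interp_dist_triangle.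

Lemma interp_compact : compact [set: metric_space d1] ->
  compact [set: metric_space interp_metric].
Proof.
move=> c1; pose f (x : metric_space d1) : metric_space interp_metric := x.
have -> : [set: metric_space interp_metric] = f @` setT.
  by apply/seteqP; split => x // _; exists x.
apply: continuous_compact => //.
apply: continuous_subspaceT => x P /nbhs_ballP[e /= e0 eP].
rewrite nbhs_simpl/=.
apply/(@nbhs_ballP _ (metric_space d1)); exists e => // y xey.
apply: eP; move: xey; rewrite !ballEmdist/=.
exact: le_lt_trans (interp_dist_le _ _).
Qed.

Lemma interp_positive_definite : positive_definite (metric_space d0) ->
  positive_definite (metric_space d1) ->
  positive_definite (metric_space interp_metric).
Proof.
move=> p0 p1 X.
have -> : zeta_mx (X : {fset metric_space interp_metric}) =
    (1 - t) *: zeta_mx (X : {fset metric_space d0}) +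
    t *: zeta_mx (X : {fset metric_space d1}).
  by apply/matrixP => i j; rewrite !mxE expR_interp.
have [s0 v0] := p0 X; have [s1 v1] := p1 X.
split; first by rewrite linearD/= !linearZ/= s0 s1.
move=> v vN0; rewrite mulmxDr mulmxDl -!scalemxAr -!scalemxAl !mxE.
by have := v0 _ vN0; have := v1 _ vN0; rewrite !mxE; have := t01; nra.
Qed.

End interpolation.

Lemma conv01 (R : realType) (s u l : R) :
  0 <= s <= 1 -> 0 <= u <= 1 -> 0 <= l <= 1 ->
  0 <= (1 - l) * s + l * u <= 1.
Proof. by move=> ? ? ?; apply/andP; split; nra. Qed.

(* Main.v *)
Require Import Defs.
From mathcomp Require Import all_boot all_order all_algebra finmap.
From mathcomp Require Import boolp classical_sets reals ereal topology.
From mathcomp Require Import sequences ring lra.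

Import Order.TTheory GRing.Theory Num.Theory.

Local Open Scope classical_set_scope.
Local Open Scope ring_scope.

(** For a positive definite matrix [A] one has the variational formula
    [w^T A^-1 w = max_v (2 w^T v - v^T A v)], attained at [v = A^-1 w].  The
    right-hand side is a maximum of functions that are affine in [A], so it is
    convex in [A].  The zeta matrix of a finite subset is affine in the
    interpolation parameter, so taking [w] to be the all-ones vector gives
    convexity of finite magnitudes, and this passes to suprema. *)

(** A nonzero row vector killed by a singular [A] would make the quadratic form vanish at its
    transpose. *)
Lemma posdef_unitmx {R : realType} {n : nat} {A : 'M[R]_n} :
  posdef_mx A -> A \in unitmx.
Proof.
move=> [_ pA]; rewrite unitmxE unitfE; apply/negP => /det0P[v vN0 vA0].
have vTN0 : v^T != 0 by rewrite -trmx0 (inj_eq trmx_inj).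
by have := pA _ vTN0; rewrite trmxK vA0 mul0mx mxE ltxx.
Qed.

Lemma posdef_ge0 {R : realType} {n : nat} {A : 'M[R]_n} (v : 'cV[R]_n) :
  posdef_mx A -> 0 <= (v^T *m A *m v) ord0 ord0.
Proof.
move=> [_ pA]; have [->|/pA/ltW//] := eqVneq v 0.
by rewrite mulmx0 mxE.
Qed.

(** Completing the square: the gap between the two sides is the form of [A] at
    [v - invmx A *m w]. *)
Lemma posdef_variational_le {R : realType} {n : nat} {A : 'M[R]_n}
    (w v : 'cV[R]_n) : posdef_mx A ->
  2 * (w^T *m v) ord0 ord0 - (v^T *m A *m v) ord0 ord0 <=
    (w^T *m invmx A *m w) ord0 ord0.
Proof.
move=> pA; have uA := posdef_unitmx pA; have [sA _] := pA.
(* A 1 by 1 matrix equals its transpose, so the two cross terms agree. *)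
have vw : (v^T *m w) ord0 ord0 = (w^T *m v) ord0 ord0.
  by rewrite -[v^T *m w]trmxK trmx_mul trmxK mxE.
have := posdef_ge0 (v - invmx A *m w) pA.
have -> : (v - invmx A *m w)^T *m A *m (v - invmx A *m w) =
    v^T *m A *m v - w^T *m v - (v^T *m w - w^T *m invmx A *m w).
  rewrite [(_ - _)^T]linearB/= trmx_mul trmx_inv sA !(mulmxBl, mulmxBr) !mulmxA.
  by rewrite (mulmxK uA) (mulmxKV uA).
by rewrite !mxE in vw *; lra.
Qed.

Lemma posdef_variational_eq {R : realType} {n : nat} {A : 'M[R]_n}
    (w : 'cV[R]_n) : posdef_mx A ->
  2 * (w^T *m (invmx A *m w)) ord0 ord0 -
    ((invmx A *m w)^T *m A *m (invmx A *m w)) ord0 ord0 =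
    (w^T *m invmx A *m w) ord0 ord0.
Proof.
move=> pA; have uA := posdef_unitmx pA; have [sA _] := pA.
rewrite trmx_mul trmx_inv sA !mulmxA (mulmxKV uA).
by ring.
Qed.

Lemma invmx_form_convex {R : realType} {n : nat} {A B C : 'M[R]_n} {l : R}
    (w : 'cV[R]_n) : 0 <= l <= 1 ->
  posdef_mx A -> posdef_mx B -> posdef_mx C -> C = (1 - l) *: A + l *: B ->
  (w^T *m invmx C *m w) ord0 ord0 <=
    (1 - l) * (w^T *m invmx A *m w) ord0 ord0 +
    l * (w^T *m invmx B *m w) ord0 ord0.
Proof.
move=> /andP[l0 l1] pA pB pC CE.
(* Fix the maximizer [v] for [C]. Its value splits affinely, and the same [v] is a competitor for
   both [A] and [B]. *)
rewrite -(posdef_variational_eq w pC); set v := invmx C *m w.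
have -> : (v^T *m C *m v) ord0 ord0 =
    (1 - l) * (v^T *m A *m v) ord0 ord0 + l * (v^T *m B *m v) ord0 ord0.
  rewrite CE mulmxDr mulmxDl -!scalemxAr -!scalemxAl mxE.
  by congr (_ + _); rewrite mxE.
have l1' : 0 <= 1 - l by rewrite subr_ge0.
have := ler_wpM2l l1' (posdef_variational_le w v pA).
have := ler_wpM2l l0 (posdef_variational_le w v pB).
by lra.
Qed.

Lemma fin_magnitudeE {R : realType} {M : metricType R} (X : {fset M}) :
  fin_magnitude X =
  ((const_mx 1 : 'cV_#|{: X}|)^T *m invmx (zeta_mx X) *m
    (const_mx 1 : 'cV_#|{: X}|)) ord0 ord0.
Proof.
(* The matrix product has the column sum outermost. *)
rewrite mxE /fin_magnitude exchange_big/=; apply: eq_bigr => j _.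
rewrite !mxE mulr1; apply: eq_bigr => i _.
by rewrite !mxE mul1r.
Qed.

(** Stated for any three metrics related through their exponentials, so that it serves both for the
    endpoints [d0], [d1] and for two interpolated metrics. *)
Lemma magnitude_convex {R : realType} {K : choiceType}
    {da db dc : metric R K} {l : R} : 0 <= l <= 1 ->
  (forall x y, expR (- dc x y) =
    (1 - l) * expR (- da x y) + l * expR (- db x y)) ->
  positive_definite (metric_space da) ->
  positive_definite (metric_space db) ->
  positive_definite (metric_space dc) ->
  (magnitude (metric_space dc) <=
    (1 - l)%:E * magnitude (metric_space da) +
    l%:E * magnitude (metric_space db))%E.
Proof.
move=> l01 dcE pa pb pc; apply: ge_ereal_sup => _ [X _ <-].
have /andP[l0 l1] := l01.
(* The same finite set [X] is measured in all three metrics, since each space is an alias of [K]. *)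
apply: (@le_trans _ _
  ((1 - l)%:E * (@fin_magnitude R (metric_space da) X)%:E +
   l%:E * (@fin_magnitude R (metric_space db) X)%:E)%E); last first.
  apply: leeD; apply: lee_wpmul2l; rewrite ?lee_fin ?subr_ge0//;
    by apply: ereal_sup_ubound; exists X.
rewrite -!EFinM -EFinD lee_fin !fin_magnitudeE.
apply: invmx_form_convex l01 (pa X) (pb X) (pc X) _.
by apply/matrixP => i j; rewrite !mxE dcE.
Qed.

Theorem theorem1p4 (R : realType) (K : choiceType) (d0 d1 : metric R K)
  (led : forall x y : K, d0 x y <= d1 x y)
  (compact0 : compact [set: metric_space d0])
  (posdef0 : positive_definite (metric_space d0))
  (compact1 : compact [set: metric_space d1])
  (posdef1 : positive_definite (metric_space d1)) :
  (forall (t : R) (t01 : 0 <= t <= 1),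
     (magnitude (metric_space (interp_metric led t01)) <=
      (1 - t)%:E * magnitude (metric_space d0) +
      t%:E * magnitude (metric_space d1))%E) /\
  (forall (s u l : R) (s01 : 0 <= s <= 1) (u01 : 0 <= u <= 1)
     (l01 : 0 <= l <= 1),
     (magnitude (metric_space (interp_metric led (conv01 s01 u01 l01))) <=
      (1 - l)%:E * magnitude (metric_space (interp_metric led s01)) +
      l%:E * magnitude (metric_space (interp_metric led u01)))%E).
Proof.
have pd t (t01 : 0 <= t <= 1) :
    positive_definite (metric_space (interp_metric led t01)).
  exact: interp_positive_definite.
split=> [t t01|s u l s01 u01 l01]; apply: magnitude_convex => // x y.
  exact: expR_interp.
(* The exponential is affine in the parameter, so mixing parameters [s] and [u] with weight [l]
   mixes the exponentials. *)
rewrite /= !expR_interp//; first by ring.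
exact: conv01.
Qed.
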